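(* Let $n,m,M$ be positive integers, let $(A_i,B_i)\in\mathbb{R}^{n\times n}\times\mathbb{R}^{n\times m}$ for $i\in\langle M\rangle$, and let $\mathcal{G}=(S,E)$ be a complete and deterministic graph on $\langle M\rangle$. There exist $\{P_s\}_{s\in S}\subset\mathbb{S}_+^{n\times n}$ and $\{K_{s,i}\}_{s\in S,\,i\in\langle M\rangle}\subset\mathbb{R}^{m\times n}$ such that $$(A_i+B_iK_{a,i})^\top P_b(A_i+B_iK_{a,i})-P_a\prec 0\qquad\text{for all } (a,b,i)\in E \tag{1}$$ if and only if there exist $\{\overline{P}_s\}_{s\in S}\subset\mathbb{S}^{n\times n}$ and $\{\overline{K}_{s,i}\}_{s\in S,\,i\in\langle M\rangle}\subset\mathbb{R}^{m\times n}$ such that $$\begin{bmatrix}\overline{P}_b & A_i\overline{P}_a+B_i\overline{K}_{a,i}\\ (A_i\overline{P}_a+B_i\overline{K}_{a,i})^\top & \overline{P}_a\end{bmatrix}\succ 0\qquad\text{for all }(a,b,i)\in E. \tag{2}$$ Moreover, given $\{\overline{P}_s\}$, $\{\overline{K}_{s,i}\}$ satisfying (2), matrices $\{P_s\}_{s\in S}\subset\mathbb{S}_+^{n\times n}$, $\{K_{s,i}\}_{s\in S,\,i\in\langle M\rangle}\subset\mathbb{R}^{m\times n}$ satisfying (1) are given by $P_s=\overline{P}_s^{-1}$ and $K_{s,i}=\overline{K}_{s,i}\overline{P}_s^{-1}$.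
   Context: Notation: $\langle M\rangle:=\{1,\dots,M\}$; $\mathbb{S}^{n\times n}$ is the set of symmetric real $n\times n$ matrices and $\mathbb{S}_+^{n\times n}$ the set of symmetric positive definite ones; $X\succ0$ (resp. $X\prec 0$) means positive (resp. negative) definite. Graphs: a (labeled, directed) graph $\mathcal{G}=(S,E)$ on $\langle M\rangle$ consists of a finite set of nodes $S$ and a set of labeled edges $E\subset S\times S\times\langle M\rangle$. It is complete if for all $a\in S$ and all $i\in\langle M\rangle$ there exists at least one $b\in S$ with $(a,b,i)\in E$. It is deterministic if for all $a\in S$ and all $i\in\langle M\rangle$ there exists at most one $b\in S$ with $(a,b,i)\in E$. *)

(* Defs.v *)
From HB Require Import structures.
From mathcomp Require Import all_boot all_order all_algebra.
From mathcomp Require Import reals.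

Set Implicit Arguments.
Unset Strict Implicit.
Unset Printing Implicit Defensive.

Import Order.TTheory GRing.Theory Num.Theory.
Local Open Scope ring_scope.

(* Symmetry is part of both definitions: without it, x^T X x only sees the
   symmetric part of X. *)
Definition posdefmx (R : realType) (n : nat) (X : 'M[R]_n) : Prop :=
  X \is symmetricmx /\
  forall x : 'cV[R]_n, x != 0 -> 0 < (x^T *m X *m x) 0 0.

Definition negdefmx (R : realType) (n : nat) (X : 'M[R]_n) : Prop :=
  X \is symmetricmx /\
  forall x : 'cV[R]_n, x != 0 -> (x^T *m X *m x) 0 0 < 0.

(* A labeled graph on {1, ..., M} is given by its finite type of nodes S and
   its set of edges E; the triple (a, b, i) is an edge from a to b with label i,
   and the labels 1, ..., M are represented by 'I_M, i.e. by 0, ..., M - 1. *)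
Definition complete_graph (S : finType) (M : nat)
    (E : {set S * S * 'I_M}) : Prop :=
  forall (a : S) (i : 'I_M), exists b : S, (a, b, i) \in E.

Definition deterministic_graph (S : finType) (M : nat)
    (E : {set S * S * 'I_M}) : Prop :=
  forall (a : S) (i : 'I_M) (b c : S),
    (a, b, i) \in E -> (a, c, i) \in E -> b = c.

Definition closed_loop_lyapunov (R : realType) (n m M : nat) (S : finType)
    (E : {set S * S * 'I_M}) (A : 'I_M -> 'M[R]_n) (B : 'I_M -> 'M[R]_(n, m))
    (P : S -> 'M[R]_n) (K : S -> 'I_M -> 'M[R]_(m, n)) : Prop :=
  forall (a b : S) (i : 'I_M), (a, b, i) \in E ->
    negdefmx ((A i + B i *m K a i)^T *m P b *m (A i + B i *m K a i) - P a).

Definition closed_loop_lmi (R : realType) (n m M : nat) (S : finType)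
    (E : {set S * S * 'I_M}) (A : 'I_M -> 'M[R]_n) (B : 'I_M -> 'M[R]_(n, m))
    (P : S -> 'M[R]_n) (K : S -> 'I_M -> 'M[R]_(m, n)) : Prop :=
  forall (a b : S) (i : 'I_M), (a, b, i) \in E ->
    posdefmx (block_mx (P b)                           (A i *m P a + B i *m K a i)
                       (A i *m P a + B i *m K a i)^T   (P a)).

(* Main.v *)
(** The matrices of the two inequalities are related by
    [Pbar s = P s ^-1] and [Kbar s i = K s i *m P s ^-1]: with
    [C = A i + B i *m K a i] the off-diagonal block of the LMI is
    [C *m Pbar a], and by the Schur complement the LMI is positivity of
    [Pbar a - Pbar a *m C^T *m P b *m C *m Pbar a], which is congruent, through
    [Pbar a], to [P a - C^T *m P b *m C]. *)
Require Import Defs.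
From HB Require Import structures.
From mathcomp Require Import all_boot all_order all_algebra.
From mathcomp Require Import reals.

Set Implicit Arguments.
Unset Strict Implicit.
Unset Printing Implicit Defensive.

Import Order.TTheory GRing.Theory Num.Theory.
Local Open Scope ring_scope.

Lemma symmetricmxP (R : realType) (n : nat) (X : 'M[R]_n) :
  reflect (X^T = X) (X \is symmetricmx).
Proof.
by rewrite is_hermitianmxE expr0 scale1r map_mx_id // eq_sym; apply: eqP.
Qed.

Lemma negdefmxE (R : realType) (n : nat) (X : 'M[R]_n) :
  negdefmx X <-> posdefmx (- X).
Proof.
have quadN (x : 'cV[R]_n) : (x^T *m - X *m x) 0 0 = - (x^T *m X *m x) 0 0.
  by rewrite mulmxN mulNmx mxE.
split=> -[/symmetricmxP sX qX].
  split=> [|x /qX]; last by rewrite quadN oppr_gt0.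
  by apply/symmetricmxP; rewrite linearN /= sX.
split=> [|x /qX]; last by rewrite quadN oppr_gt0.
by apply/symmetricmxP; apply: oppr_inj; rewrite -[in RHS]sX linearN.
Qed.

(** The left inverse [V] makes [U] injective, so the quadratic form of [X] is only evaluated at
    nonzero vectors [U *m x]. Since [U] may be rectangular, this covers compression to a diagonal
    block as well as invertible changes of basis. *)
Lemma posdefmx_congr (R : realType) (n p : nat) (V : 'M[R]_(n, p))
    (U : 'M[R]_(p, n)) (X : 'M[R]_p) :
  V *m U = 1%:M -> posdefmx X -> posdefmx (U^T *m X *m U).
Proof.
move=> VU [/symmetricmxP sX qX]; split=> [|x x0].
  by apply/symmetricmxP; rewrite !trmx_mul trmxK sX mulmxA.
have Ux0 : U *m x != 0.
  by apply: contraNneq x0 => Ux; rewrite -[x]mul1mx -VU -mulmxA Ux mulmx0.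
by have := qX _ Ux0; rewrite trmx_mul !mulmxA.
Qed.

Lemma posdefmx_unit (R : realType) (n : nat) (X : 'M[R]_n) :
  posdefmx X -> X \in unitmx.
Proof.
move=> [_ qX]; rewrite unitmxE unitfE; apply/det0P => -[v v0 vX].
have /qX : v^T != 0 by rewrite -trmx0 (inj_eq trmx_inj).
by rewrite trmxK vX mul0mx mxE ltxx.
Qed.

Lemma posdefmx_inv (R : realType) (n : nat) (X : 'M[R]_n) :
  posdefmx X -> posdefmx (invmx X).
Proof.
move=> pX; have uX := posdefmx_unit pX; have [/symmetricmxP sX _] := pX.
(* By symmetry, the inverse is congruent to [X] through itself. *)
have -> : invmx X = (invmx X)^T *m X *m invmx X.
  by rewrite mulmxK // trmx_inv sX.
exact: posdefmx_congr (mulmxV uX) pX.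
Qed.

Lemma posdefmx_drsub (R : realType) (n p : nat) (X : 'M[R]_n)
    (Y : 'M[R]_(n, p)) (W : 'M[R]_(p, n)) (Z : 'M[R]_p) :
  posdefmx (block_mx X Y W Z) -> posdefmx Z.
Proof.
(* Congruence by the inclusion [col_mx 0 1%:M] of the last [p] coordinates cuts out the block
   [Z]. *)
have VU : row_mx (0 : 'M[R]_(p, n)) 1%:M *m col_mx 0 1%:M = 1%:M :> 'M_p.
  by rewrite mul_row_col mul0mx mulmx1 add0r.
move=> /(posdefmx_congr VU).
rewrite tr_col_mx trmx0 trmx1 mul_row_block mul_row_col.
by rewrite !(mul0mx, mulmx0, mul1mx, mulmx1, add0r).
Qed.

Lemma posdefmx_block_diag (R : realType) (n p : nat) (X : 'M[R]_n)
    (Z : 'M[R]_p) :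
  posdefmx X -> posdefmx Z -> posdefmx (block_mx X 0 0 Z).
Proof.
move=> [/symmetricmxP sX qX] [/symmetricmxP sZ qZ]; split=> [|x].
  by apply/symmetricmxP; rewrite tr_block_mx !trmx0 sX sZ.
rewrite -[x]vsubmxK; move: (usubmx x) (dsubmx x) => u v.
rewrite col_mx_eq0 tr_col_mx mul_row_block mul_row_col !mulmx0 addr0 add0r.
rewrite mxE; have [->|u0] := eqVneq u 0; have [->|v0] := eqVneq v 0 => //= _.
- by rewrite mulmx0 [X in X + _]mxE add0r qZ.
- by rewrite mulmx0 [X in _ + X]mxE addr0 qX.
- by rewrite addr_gt0 ?qX ?qZ.
Qed.

(** Block elimination: with [T = invmx X *m Y], the unipotent matrix [L T], whose inverse is
    [L (- T)], makes the block matrix congruent to the block diagonal matrix of [X] and its Schur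
    complement. *)
Lemma posdefmx_schur (R : realType) (n p : nat) (X : 'M[R]_n)
    (Y : 'M[R]_(n, p)) (Z : 'M[R]_p) :
  posdefmx X ->
  posdefmx (block_mx X Y Y^T Z) <-> posdefmx (Z - Y^T *m invmx X *m Y).
Proof.
move=> pX; have uX := posdefmx_unit pX; have [/symmetricmxP sX _] := pX.
pose L (T : 'M[R]_(n, p)) := block_mx 1%:M T 0 1%:M.
have LL T : L (- T) *m L T = 1%:M.
  rewrite mulmx_block !(mul0mx, mulmx0, mul1mx, mulmx1, addr0, add0r).
  by rewrite subrr -scalar_mx_block.
set T := invmx X *m Y.
have trT : T^T = Y^T *m invmx X by rewrite trmx_mul trmx_inv sX.
have LDL : block_mx X Y Y^T Z =
    (L T)^T *m block_mx X 0 0 (Z - Y^T *m invmx X *m Y) *m L T.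
  rewrite tr_block_mx trmx0 !trmx1 !mulmx_block trT.
  rewrite !(mul0mx, mulmx0, mul1mx, mulmx1, addr0, add0r).
  by rewrite mulmxKV // mulKVmx // mulmxA addrC subrK.
split=> [pB|pS]; last first.
  by rewrite LDL; apply: posdefmx_congr (LL T) _; apply: posdefmx_block_diag.
have LLN : L T *m L (- T) = 1%:M by rewrite -{1}[T]opprK LL.
(* Congruence by [L (- T)] undoes the factorization, leaving the Schur complement as the lower right
   block. *)
have := posdefmx_congr LLN pB.
rewrite LDL !mulmxA -trmx_mul LLN trmx1 mul1mx -mulmxA LLN mulmx1.
exact: posdefmx_drsub.
Qed.

(* Congruence by [Qa] turns [invmx Qa - C^T *m invmx Qb *m C] into the Schur
   complement of [Qb] in the block matrix. *)
Lemma posdefmx_lyapunov_lmi (R : realType) (n : nat) (Qa Qb C : 'M[R]_n) :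
  posdefmx Qa -> posdefmx Qb ->
  posdefmx (block_mx Qb (C *m Qa) (C *m Qa)^T Qa) <->
  negdefmx (C^T *m invmx Qb *m C - invmx Qa).
Proof.
move=> pa pb; have ua := posdefmx_unit pa; have [/symmetricmxP sa _] := pa.
rewrite posdefmx_schur // negdefmxE opprB.
have QSQ : Qa - (C *m Qa)^T *m invmx Qb *m (C *m Qa) =
    Qa^T *m (invmx Qa - C^T *m invmx Qb *m C) *m Qa.
  by rewrite trmx_mul sa mulmxBr mulmxBl mulmxV // mul1mx !mulmxA.
rewrite QSQ; split=> [|pS]; last exact: posdefmx_congr (mulVmx ua) pS.
(* Congruence by [invmx Qa] cancels the outer factors [Qa]. *)
move=> /(posdefmx_congr (mulmxV ua)).
by rewrite !mulmxA -trmx_mul mulmxV // trmx1 mul1mx mulmxK.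
Qed.

(** The change of variables that makes the problem linear: the off-diagonal block becomes the
    closed-loop matrix with gain [K *m invmx Q], times [Q]. *)
Lemma closed_loopM (R : realType) (n m : nat) (A : 'M[R]_n)
    (B : 'M[R]_(n, m)) (Q : 'M[R]_n) (K : 'M[R]_(m, n)) :
  Q \in unitmx -> A *m Q + B *m K = (A + B *m (K *m invmx Q)) *m Q.
Proof. by move=> uQ; rewrite mulmxDl -!mulmxA mulVmx // mulmx1. Qed.

Theorem lemma2 (R : realType) (n m M : nat)
    (n_gt0 : (0 < n)%N) (m_gt0 : (0 < m)%N) (M_gt0 : (0 < M)%N)
    (A : 'I_M -> 'M[R]_n) (B : 'I_M -> 'M[R]_(n, m))
    (S : finType) (E : {set S * S * 'I_M})
    (E_complete : complete_graph E) (E_deterministic : deterministic_graph E) :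
  ((exists (P : S -> 'M[R]_n) (K : S -> 'I_M -> 'M[R]_(m, n)),
      (forall s : S, posdefmx (P s)) /\ closed_loop_lyapunov E A B P K)
   <->
   (exists (Pbar : S -> 'M[R]_n) (Kbar : S -> 'I_M -> 'M[R]_(m, n)),
      (forall s : S, Pbar s \is symmetricmx) /\
      closed_loop_lmi E A B Pbar Kbar))
  /\
  (forall (Pbar : S -> 'M[R]_n) (Kbar : S -> 'I_M -> 'M[R]_(m, n)),
     (forall s : S, Pbar s \is symmetricmx) ->
     closed_loop_lmi E A B Pbar Kbar ->
     (forall s : S, posdefmx (invmx (Pbar s))) /\
     closed_loop_lyapunov E A B
       (fun s => invmx (Pbar s)) (fun s i => Kbar s i *m invmx (Pbar s))).
Proof.
(* Completeness provides an edge out of each node [s], so [Pbar s] occurs as a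
   diagonal block of some positive definite matrix. *)
have lmi_posdef Pbar Kbar s : closed_loop_lmi E A B Pbar Kbar ->
    posdefmx (Pbar s).
  move=> lmi; have [b sbE] := E_complete s (Ordinal M_gt0).
  exact: posdefmx_drsub (lmi _ _ _ sbE).
have lmi_lyapunov Pbar Kbar : closed_loop_lmi E A B Pbar Kbar ->
    closed_loop_lyapunov E A B
      (fun s => invmx (Pbar s)) (fun s i => Kbar s i *m invmx (Pbar s)).
  move=> lmi a b i abE; have pP s := lmi_posdef _ _ s lmi.
  apply/(posdefmx_lyapunov_lmi _ (pP a) (pP b)).
  by rewrite -closed_loopM ?posdefmx_unit //; apply: lmi.
split; last first.
  move=> Pbar Kbar _ lmi; split; last exact: lmi_lyapunov.
  by move=> s; apply: posdefmx_inv; apply: lmi_posdef lmi.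
split=> [[P [K [pP lyap]]]|[Pbar [Kbar [_ lmi]]]]; last first.
  exists (fun s => invmx (Pbar s)), (fun s i => Kbar s i *m invmx (Pbar s)).
  split; last exact: lmi_lyapunov.
  by move=> s; apply: posdefmx_inv; apply: lmi_posdef lmi.
have pQ s := posdefmx_inv (pP s); have uP s := posdefmx_unit (pP s).
exists (fun s => invmx (P s)), (fun s i => K s i *m invmx (P s)).
split=> [s|a b i abE]; first by case: (pQ s).
(* Here [Q] is [invmx (P a)], so the gain [K a i *m invmx (P a) *m invmx Q] collapses to the
   original [K a i]. *)
rewrite closed_loopM ?posdefmx_unit // invmxK mulmxKV //.
by apply/(posdefmx_lyapunov_lmi _ (pQ a) (pQ b)); rewrite !invmxK; apply: lyap.
Qed.
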